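(* Let $(T,X)$ be a semiflow on a compact Hausdorff space $X$. Then: (1) If $(T,X)$ is equicontinuous and surjective, then it is distal. (2) If $(T,X)$ is distal, then it is invertible. (3) If $(T,X)$ is distal, then so is the flow $(\langle T\rangle,X)$. (4) If $(T,X)$ is invertible and equicontinuous, then $(\langle T\rangle,X)$ is an equicontinuous flow.
   Context: $X$ is a nonempty compact Hausdorff space, $\mathscr U_X$ is its compatible uniformity (symmetric entourages), and $T$ is a discrete infinite semigroup with identity $e$. A semiflow $(T,X)$ is a continuous map $T\times X\to X$, $(t,x)\mapsto tx$, with $ex=x$ and $t(sx)=(ts)x$. It is a flow if $T$ is a group. $(T,X)$ is surjective if $tX=X$ for every $t\in T$; invertible if for every $t\in T$ the map $x\mapsto tx$ is a bijection of $X$. In the invertible case $\langle T\rangle$ is the smallest group of self-homeomorphisms of $X$ containing (the maps given by) $T$, with the discrete topology, and $(\langle T\rangle,X)$ is the resulting flow. $(T,X)$ is equicontinuous if for every $\varepsilon\in\mathscr U_X$ there is $\delta\in\mathscr U_X$ such that $(x,y)\in\delta$ implies $(tx,ty)\in\varepsilon$ for all $t\in T$. $(T,X)$ is distal if for all $x\neq y$ in $X$ there is $\alpha\in\mathscr U_X$ with $(tx,ty)\notin\alpha$ for every $t\in T$. *)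

(* Defs.v *)
From HB Require Import structures.
From mathcomp Require Import all_boot all_order all_algebra.
From mathcomp Require Import all_classical all_reals all_analysis.

Set Implicit Arguments.
Unset Strict Implicit.
Unset Printing Implicit Defensive.

Local Open Scope classical_set_scope.

(* The acting monoid carries the discrete topology, and the action is jointly
   continuous. *)
Record semiflow (T : monoidType) (X : topologicalType) := Semiflow {
  act :> T -> X -> X;
  act_continuous :
    continuous (fun p : (discrete_topology T * X)%type => act p.1 p.2);
  act1 : forall x, act 1%g x = x;
  actM : forall t s x, act t (act s x) = act (t * s)%g x }.

Definition flow (T : groupType) (X : topologicalType) := semiflow T X.

Definition sym_entourage (X : uniformType) : set_system (X * X) :=
  [set E | entourage E /\ (E^-1)%relation = E].

Section properties.
Context (T : monoidType).

Definition surjective (X : topologicalType) (phi : semiflow T X) :=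
  forall t, phi t @` [set: X] = [set: X].

Definition invertible (X : topologicalType) (phi : semiflow T X) :=
  forall t, bijective (phi t).

Definition equicontinuous_semiflow (X : uniformType) (phi : semiflow T X) :=
  forall eps : set (X * X), sym_entourage eps ->
  exists2 delta : set (X * X), sym_entourage delta &
    forall x y, delta (x, y) -> forall t, eps (phi t x, phi t y).

Definition distal (X : uniformType) (phi : semiflow T X) :=
  forall x y : X, x <> y ->
  exists2 alpha : set (X * X), sym_entourage alpha &
    forall t, ~ alpha (phi t x, phi t y).

End properties.

Record homeo (X : topologicalType) := Homeo {
  homeo_fun :> X -> X;
  homeo_inv : X -> X;
  homeoK : cancel homeo_fun homeo_inv;
  homeoVK : cancel homeo_inv homeo_fun;
  homeo_continuous : continuous homeo_fun;
  homeoV_continuous : continuous homeo_inv }.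

Section homeo_group.
Context (X : topologicalType).
Implicit Types f g h : homeo X.

Lemma homeoP f g : f =1 g -> f = g.
Proof.
case: f g => f f' fK f'K cf cf' [g g' gK g'K cg cg'] /= fg.
have {}fg : f = g by apply/funext.
subst g; have gf : f' = g'.
  by apply/funext => x; rewrite -[in LHS](g'K x) fK.
by subst g'; congr Homeo; exact: Prop_irrelevance.
Qed.

HB.instance Definition _ := gen_eqMixin (homeo X).
HB.instance Definition _ := gen_choiceMixin (homeo X).

Definition homeo1 : homeo X :=
  @Homeo X id id (fun=> erefl) (fun=> erefl)
    (fun x => @cvg_id _ (nbhs x)) (fun x => @cvg_id _ (nbhs x)).

Definition homeo_invh f : homeo X :=
  Homeo (homeoVK f) (homeoK f) (@homeoV_continuous _ f) (@homeo_continuous _ f).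

Definition homeo_comp f g : homeo X :=
  @Homeo X (f \o g) (homeo_inv g \o homeo_inv f)
    (can_comp (homeoK f) (homeoK g)) (can_comp (homeoVK g) (homeoVK f))
    (fun x => continuous_comp (@homeo_continuous _ g x)
                              (@homeo_continuous _ f (g x)))
    (fun x => continuous_comp (@homeoV_continuous _ f x)
                              (@homeoV_continuous _ g (homeo_inv f x))).

Fact homeo_compA : associative homeo_comp.
Proof. by move=> f g h; apply: homeoP. Qed.

Fact homeo_comp1h : left_id homeo1 homeo_comp.
Proof. by move=> f; apply: homeoP. Qed.

Fact homeo_comph1 : right_id homeo1 homeo_comp.
Proof. by move=> f; apply: homeoP. Qed.

Fact homeo_compVh : left_inverse homeo1 homeo_invh homeo_comp.
Proof. by move=> f; apply: homeoP => x; exact: homeoK. Qed.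

Fact homeo_comphV : right_inverse homeo1 homeo_invh homeo_comp.
Proof. by move=> f; apply: homeoP => x; exact: homeoVK. Qed.

HB.instance Definition _ := isGroup.Build (homeo X)
  homeo_compA homeo_comp1h homeo_comph1 homeo_compVh homeo_comphV.

Lemma homeo1E x : (1%g : homeo X) x = x. Proof. by []. Qed.

Lemma homeoME f g x : (f * g)%g x = f (g x). Proof. by []. Qed.

Lemma homeoVE f : (f^-1)%g = homeo_inv f :> (X -> X). Proof. by []. Qed.

End homeo_group.

Definition subgroup (G : groupType) : set_system G :=
  [set H : set G | [/\ H 1%g, forall g h, H g -> H h -> H (g * h)%g
                    & forall g, H g -> H (g^-1)%g]].

(* The self-homeomorphisms of X given by elements of T.  When phi is invertible
   and X is compact Hausdorff, every t in T gives one: see invertible_homeo. *)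
Definition act_homeos (T : monoidType) (X : topologicalType)
    (phi : semiflow T X) : set (homeo X) :=
  [set h : homeo X | exists t, h =1 phi t].

Definition gen_set (T : monoidType) (X : topologicalType)
    (phi : semiflow T X) : set (homeo X) :=
  smallest (@subgroup (homeo X)) (act_homeos phi).

Definition gen_group (T : monoidType) (X : topologicalType)
    (phi : semiflow T X) : Type := {h : homeo X | h \in gen_set phi}.

Section gen_group.
Context (T : monoidType) (X : topologicalType) (phi : semiflow T X).

Fact gen_set_subgroup : subgroup (gen_set phi).
Proof.
split=> [H [[]]//|g h Gg Gh H HP|g Gg H HP].
- by case: (HP) => -[_ HM _] _; apply: HM; [exact: Gg | exact: Gh].
- by case: (HP) => -[_ _ HV] _; apply: HV; exact: Gg.
Qed.

HB.instance Definition _ := SubChoice.on (gen_group phi).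

Fact gen_set_closed : group_closed [pred h | h \in gen_set phi].
Proof.
have [G1 GM GV] := gen_set_subgroup.
split=> [|g h /set_mem Gg /set_mem Gh]; first exact/mem_set.
by apply/mem_set; apply: GM => //; apply: GV.
Qed.

HB.instance Definition _ :=
  SubChoice_isSubGroup.Build (homeo X) _ (gen_group phi) gen_set_closed.

Definition gen_act (g : gen_group phi) : X -> X := val g.

Fact gen_act_continuous :
  continuous (fun p : (discrete_topology (gen_group phi) * X)%type =>
                gen_act p.1 p.2).
Proof.
move=> [g x] U /= Ugx.
exists ([set g], gen_act g @^-1` U).
  split=> /=; first exact: discrete_set1.
  exact: (homeo_continuous Ugx).
by move=> [h y] /= [-> ].
Qed.

Fact gen_act1 x : gen_act 1%g x = x. Proof. by []. Qed.

Fact gen_actM g h x : gen_act g (gen_act h x) = gen_act (g * h)%g x.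
Proof. by []. Qed.

Definition gen_flow : flow (gen_group phi) X :=
  Semiflow gen_act_continuous gen_act1 gen_actM.

End gen_group.

Lemma semiflow_continuous (T : monoidType) (X : topologicalType)
  (phi : semiflow T X) t : continuous (phi t).
Proof.
move=> x U Ux.
have [[A B] /= [At Bx] ABU] := @act_continuous _ _ phi (t, x) U Ux.
apply: filterS Bx => y By; apply: (ABU (t, y)); split=> //=.
exact: nbhs_singleton At.
Qed.

Lemma invertible_homeo (T : monoidType) (X : topologicalType)
    (phi : semiflow T X) :
  compact [set: X] -> hausdorff_space X -> invertible phi ->
  forall t, exists2 h, act_homeos phi h & h =1 phi t.
Proof.
move=> cX hX iphi t; have [g gK Kg] := iphi t.
have cg : continuous g.
  apply/continuous_closedP => A cA.
  have -> : g @^-1` A = phi t @` A.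
    apply/seteqP; split=> [y Ay|_ [x Ax <-]]; last by rewrite /= gK.
    by exists (g y).
  apply: compact_closed => //; apply: continuous_compact.
    exact/continuous_subspaceT/semiflow_continuous.
  exact: (subclosed_compact cA cX).
by exists (Homeo gK Kg (@semiflow_continuous _ _ phi t) cg) => //; exists t.
Qed.

(* Main.v *)
Require Import Defs.
From mathcomp Require Import all_boot all_order all_algebra.
From mathcomp Require Import all_classical all_reals all_analysis.

(* Let E be the Ellis semigroup, the closure of T in X^X for pointwise
   convergence.  If the only idempotent of E is the identity, then applying the
   Ellis-Numakura theorem to the closure of the positive powers of a continuous
   f in E shows that the identity is a limit of such powers.  The hypothesis on
   idempotents holds when the elements of E are injective (distal case) or
   surjective (equicontinuous surjective case).  Recurrence makes every t
   surjective in the distal case, puts the inverses of the homeomorphisms in E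
   back into E, so that <T> lies in E, and carries an equicontinuity estimate
   at (tx, ty) back to (x, y), so that a proximal pair is trivial.  Distality
   and equicontinuity of T pass to E, hence to <T>. *)

Set Implicit Arguments.
Unset Strict Implicit.
Unset Printing Implicit Defensive.

Local Open Scope classical_set_scope.

(** * The topology of pointwise convergence on maps *)

Lemma ptws_cvg (X Y : topologicalType) (F : set_system {ptws X -> Y})
    (f : {ptws X -> Y}) :
  Filter F -> (forall x, (fun g : {ptws X -> Y} => g x) @ F --> f x) -> F --> f.
Proof.
move=> FF Ff; apply/cvg_sup => x A [B [[C oC <-] Cfx] CA].
by apply: (filterS CA); apply: (Ff x C); exact: open_nbhs_nbhs.
Qed.

Lemma ptws_continuous (X Y Z : topologicalType) (h : Z -> {ptws X -> Y}) :
  (forall x, continuous (fun z => h z x)) -> continuous h.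
Proof. by move=> hc z; apply: ptws_cvg => x; exact: hc. Qed.

Lemma eval_continuous (X Y : topologicalType) x :
  continuous (fun p : {ptws X -> Y} => p x).
Proof. exact: (@proj_continuous X (fun=> Y) x). Qed.

(** Composition is continuous in its left factor for any right factor, but in its right factor when
    the left one is continuous. This fixes the order of limits below. *)
Lemma precomp_continuous (X : topologicalType) (q : X -> X) :
  continuous (fun p : {ptws X -> X} => (p \o q : {ptws X -> X})).
Proof. by apply: ptws_continuous => x; exact: eval_continuous. Qed.

Lemma postcomp_continuous (X : topologicalType) (f : X -> X) :
  continuous f ->
  continuous (fun p : {ptws X -> X} => (f \o p : {ptws X -> X})).
Proof.
move=> fc; apply: ptws_continuous => x p.
by apply: (@continuous_comp _ _ _ (fun p : {ptws X -> X} => p x) f);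
  [exact: eval_continuous | exact: fc].
Qed.

(** The hypothesis asks for [closure B] rather than [B], so that limits can be taken one variable at
    a time. *)
Lemma closure_image (Y Z : topologicalType) (h : Y -> Z) (A : set Y)
    (B : set Z) :
  continuous h -> (forall y, A y -> closure B (h y)) ->
  forall y, closure A y -> closure B (h y).
Proof.
move=> hc hAB y Ay; apply: (@closed_closure _ B) => U /hc /Ay[z [Az Uz]].
by exists (h z); split; [exact: hAB|].
Qed.

Lemma ptws_compact (X : topologicalType) :
  compact [set: X] -> compact [set: {ptws X -> X}].
Proof.
move=> cX; have := @tychonoff X (fun=> X) (fun=> setT) (fun=> cX).
by congr compact; apply/seteqP; split.
Qed.

Lemma ptws_hausdorff (X : topologicalType) :
  hausdorff_space X -> hausdorff_space {ptws X -> X}.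
Proof. by move=> hX; exact: (@hausdorff_product X (fun=> X) (fun=> hX)). Qed.

(** * Idempotents in compact semigroups of maps *)

Section ellis_numakura.
Context (X : topologicalType).
Hypotheses (cptX : compact [set: X]) (hausX : hausdorff_space X).

Let closed_semigroup (S : set {ptws X -> X}) :=
  [/\ S !=set0, closed S & forall p q, S p -> S q -> S (p \o q)].

(** Zorn's lemma for unions of chains yields a maximal set [A] to remove from [S0]; compactness
    keeps what a chain leaves nonempty. *)
Lemma minimal_closed_semigroup S0 : closed_semigroup S0 ->
  exists S, [/\ S `<=` S0, closed_semigroup S &
    forall S', S' `<=` S -> closed_semigroup S' -> S' = S].
Proof.
move=> S0P; have [S00 S0c S0M] := S0P.
have [F FP Ftot|A [AP Amax]] :=
    @Zorn_bigcup _ [set A | closed_semigroup (S0 `\` A)].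
  rewrite /=; have -> : S0 `\` \bigcup_(A in F) A = S0 `&` \bigcap_(A in F) (S0 `\` A).
    apply/seteqP; split=> [p [Sp nFp]|p [Sp Fp]].
      by split=> // A FA; split=> // Ap; apply: nFp; exists A.
    by split=> // -[A FA Ap]; have [] := Fp A FA.
  split.
  - have [->|/set0P[A0 FA0]] := eqVneq F set0.
      by rewrite bigcap_set0 setIT.
    have PG : ProperFilter (filter_from F (fun A => S0 `\` A)).
      apply: filter_from_proper; last by move=> A /FP[].
      apply: filter_from_filter; first by exists A0.
      move=> A B FA FB; case: (Ftot A B FA FB) => AB.
        by exists B => // p [Sp nBp]; do 2 split => //; move/AB.
      by exists A => // p [Sp nBp]; do 2 split => //; move/AB.
    have [p [_ pcl]] : [set: {ptws X -> X}] `&`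
        cluster (filter_from F (fun A => S0 `\` A)) !=set0.
      by apply: (@ptws_compact X cptX); exact: filterT.
    have Fp A : F A -> (S0 `\` A) p.
      move=> FA; have [_ cA _] := FP A FA; apply: cA => U Up.
      by apply: pcl => //; exists A.
    by exists p; split=> //; have [] := Fp _ FA0.
  - by apply: closedI => //; apply: closed_bigI => A /FP[].
  - move=> p q [Sp Fp] [Sq Fq]; split; first exact: S0M.
    by move=> A FA; have [_ _ AM] := FP A FA; exact: AM (Fp A FA) (Fq A FA).
exists (S0 `\` A); split=> //.
(* A smaller [S'] is what remains of [S0] once the complement of [S'] is removed, and that
   complement contains [A]. *)
move=> S' S'A S'P; have S'E : S0 `\` ~` S' = S'.
  by rewrite setDE setCK; apply/setIidPr => p /S'A[].
apply: contrapT => neq; apply: (Amax (~` S')); last by rewrite /= S'E.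
split; first by move=> p Ap /S'A[].
move=> S'nA; apply: neq; apply/seteqP; split=> // p [Sp nAp].
by apply: contrapT => nS'p; apply: nAp; exact: S'nA.
Qed.

(** Any [u] in a minimal [M] is idempotent: [M u] is a closed subsemigroup, hence all of [M], so
    some [p] in [M] has [p u = u]; such [p] again form a closed subsemigroup, so [u] is one of
    them. *)
Lemma ellis_numakura (S : set {ptws X -> X}) :
  closed S -> S !=set0 -> (forall p q, S p -> S q -> S (p \o q)) ->
  exists2 u, S u & u \o u = u.
Proof.
move=> Sc S0 SM.
have [M [MS [[u Mu] Mc MM] Mmin]] :
  exists M, [/\ M `<=` S, closed_semigroup M &
    forall S', S' `<=` M -> closed_semigroup S' -> S' = M].
  exact: minimal_closed_semigroup.
have hP := @ptws_hausdorff X hausX.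
have MuE : [set (p \o u : {ptws X -> X}) | p in M] = M.
  apply: Mmin => [_ [p Mp <-]|]; first exact: MM.
  split.
  - by exists (u \o u); exists u.
  - apply: (compact_closed hP); apply: continuous_compact.
      exact/continuous_subspaceT/precomp_continuous.
    exact: (subclosed_compact Mc (@ptws_compact X cptX)).
  - move=> _ _ [p Mp <-] [q Mq <-]; exists (p \o u \o q) => //.
    exact: MM (MM _ _ Mp Mu) Mq.
have fixE : M `&` [set p : {ptws X -> X} | p \o u = u] = M.
  apply: Mmin; first exact: subIsetl.
  split.
  - by have : M u by []; rewrite -[X in X u]MuE => -[p Mp pu]; exists p.
  - apply: closedI => //.
    apply: (@preimage_closed _ _ (fun p : {ptws X -> X} => (p \o u : {ptws X -> X}))
                            [set u]).
      by move=> p _; exact: precomp_continuous.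
    exact: (accessible_closed_set1 (hausdorff_accessible hP)).
  - move=> p q [Mp pu] [Mq qu]; split; first exact: MM.
    by rewrite /= -compA qu.
by exists u; [exact: MS | have : M u by []; rewrite -{1}fixE => -[]].
Qed.

Lemma idempotent_power (f : X -> X) : continuous f ->
  exists2 u : {ptws X -> X},
    closure (range (fun n => iter n.+1 f : {ptws X -> X})) u & u \o u = u.
Proof.
move=> fc; have itc n : continuous (iter n f).
  elim: n => [|n IHn] x; first exact: cvg_id.
  by apply: (@continuous_comp _ _ _ (iter n f) f); [exact: IHn | exact: fc].
apply: ellis_numakura; first exact: closed_closure.
  by exists f; apply: subset_closure; exists 0%N.
(* First [p] is reduced to a power of [f]; as this power is continuous, [q] can then be reduced to
   one too. *)
move=> p q + cq; move: p.
apply: (@closure_image _ _ (fun p : {ptws X -> X} => (p \o q : {ptws X -> X}))).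
  exact: precomp_continuous.
move=> _ [n _ <-]; move: q cq.
apply: (@closure_image _ _
  (fun q : {ptws X -> X} => (iter n.+1 f \o q : {ptws X -> X}))).
  exact/postcomp_continuous/itc.
move=> _ [m _ <-]; apply: subset_closure; exists (n + m.+1)%N => //.
by apply/funext => x; rewrite -addSn iterD.
Qed.

End ellis_numakura.

(** * Entourage estimates for pointwise limits *)

Section uniform_facts.
Context (X : uniformType).

Lemma hausdorff_entourage_eq (x y : X) : hausdorff_space X ->
  (forall A, entourage A -> A (x, y)) -> x = y.
Proof. by move=> hX xy; apply: (close_eq hX); rewrite entourage_close. Qed.

Lemma sym_entourage_split3 (E : set (X * X)) : entourage E ->
  exists2 D, sym_entourage D &
    forall a b c d, D (a, b) -> D (b, c) -> D (c, d) -> E (a, d).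
Proof.
move=> entE; set S := split_ent (split_ent E).
have entS : entourage S by do 2 apply: entourage_split_ent.
exists (S `&` S^-1)%relation.
  split; first exact: entourage_invI.
  by apply/seteqP; split=> -[a b] [].
move=> a b c d [ab _] [bc _] [cd _]; apply: (entourage_split c) => //.
  by apply: (entourage_split b) => //; exact: entourage_split_ent.
by apply: split_ent_subset => //; exact: entourage_split_ent.
Qed.

Lemma sym_entourageC (E : set (X * X)) a b :
  sym_entourage E -> E (a, b) -> E (b, a).
Proof. by move=> [_ EV] ab; rewrite -EV. Qed.

Lemma near_eval (p : {ptws X -> X}) x (E : set (X * X)) : entourage E ->
  nbhs p [set q : {ptws X -> X} | E (p x, q x)].
Proof.
move=> entE.
have : nbhs p ((fun q : {ptws X -> X} => q x) @^-1` xsection E (p x)).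
  exact: eval_continuous (nbhs_entourage (p x) entE).
by apply: filterS => q /= /xsectionP.
Qed.

(** Two points are approximated by a single index, since distality and equicontinuity concern
    pairs. *)
Lemma closure_range_near2 (I : Type) (F : I -> {ptws X -> X})
    (p : {ptws X -> X}) x y (E : set (X * X)) :
  closure (range F) p -> entourage E ->
  exists i, E (p x, F i x) /\ E (p y, F i y).
Proof.
move=> Fp entE.
have [_ [[i _ <-] [xi yi]]] := Fp _ (filterI (near_eval p x entE)
                                             (near_eval p y entE)).
by exists i.
Qed.

End uniform_facts.

(** * The Ellis semigroup and the estimates it inherits *)

Definition ellis (T : monoidType) (X : topologicalType) (phi : semiflow T X) :
  set {ptws X -> X} := closure (range (fun t => phi t : {ptws X -> X})).

Section ellis_semigroup.
Context (T : monoidType) (X : uniformType) (phi : semiflow T X).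

Lemma ellis_act t : ellis phi (phi t).
Proof. by apply: subset_closure; exists t. Qed.

Lemma ellis_id : ellis phi id.
Proof.
by apply: subset_closure; exists 1%g => //; apply/funext => x; rewrite act1.
Qed.

Lemma ellis_comp p q : ellis phi p -> ellis phi q -> ellis phi (p \o q).
Proof.
move=> + Eq; move: p.
apply: (@closure_image _ _ (fun p : {ptws X -> X} => (p \o q : {ptws X -> X}))).
  exact: precomp_continuous.
move=> _ [s _ <-]; move: q Eq.
apply: (@closure_image _ _
  (fun q : {ptws X -> X} => (phi s \o q : {ptws X -> X}))).
  exact/postcomp_continuous/semiflow_continuous.
move=> _ [t _ <-]; apply: subset_closure; exists (s * t)%g => //.
by apply/funext => x; rewrite -actM.
Qed.

Lemma ellis_iter f n : ellis phi f -> ellis phi (iter n f).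
Proof.
move=> Ef; elim: n => [|n IHn]; first exact: ellis_id.
exact: (ellis_comp Ef IHn).
Qed.

Lemma ellis_equicontinuous : equicontinuous_semiflow phi ->
  forall eps, sym_entourage eps -> exists2 delta, sym_entourage delta &
    forall x y, delta (x, y) -> forall p, ellis phi p -> eps (p x, p y).
Proof.
move=> eq eps [enteps _]; have [D symD DE] := sym_entourage_split3 enteps.
have [delta symdelta dD] := eq D symD; exists delta => // x y xy p Ep.
have [t [px py]] := closure_range_near2 x y Ep symD.1.
apply: (DE _ _ _ _ px (dD _ _ xy t)); exact: sym_entourageC.
Qed.

(** If [p] brought [x] and [y] too close, so would some [phi t] near [p]. *)
Lemma distal_ellis : distal phi -> forall x y, x <> y ->
  exists2 beta, sym_entourage beta &
    forall p, ellis phi p -> ~ beta (p x, p y).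
Proof.
move=> dphi x y /dphi[alpha [entalpha _] xy].
have [D symD DE] := sym_entourage_split3 entalpha; exists D => // p Ep pxy.
have [t [px py]] := closure_range_near2 x y Ep symD.1.
by apply: (xy t); apply: (DE _ _ _ _ _ pxy py); exact: sym_entourageC.
Qed.

Lemma distal_ellis_inj p : distal phi -> ellis phi p -> injective p.
Proof.
move=> dphi Ep x y pxy; apply: contrapT => xy.
have [beta [entbeta _] /(_ p Ep)] := distal_ellis dphi xy.
by apply; rewrite pxy; exact: entourage_refl.
Qed.

(** * Recurrence and its consequences on a compact Hausdorff space *)

Hypotheses (cptX : compact [set: X]) (hausX : hausdorff_space X).

(* The points z with phi t z = y, for phi t close to p, accumulate by
   compactness at some x; equicontinuity turns this into p x = y. *)
Lemma equicontinuous_ellis_surj p y :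
  equicontinuous_semiflow phi -> surjective phi -> ellis phi p ->
  exists x, p x = y.
Proof.
move=> eq sphi Ep.
pose G := filter_from (nbhs p)
  (fun W => [set z | exists2 t, W (phi t) & phi t z = y]).
have PG : ProperFilter G.
  apply: filter_from_proper.
    apply: filter_from_filter; first by exists setT; exact: filterT.
    move=> U V Up Vp; exists (U `&` V); first exact: filterI.
    by move=> z [t [Ut Vt] tz]; split; exists t.
  move=> U Up; have [_ [[t _ <-] Ut]] := Ep U Up.
  have [z _ tz] : (phi t @` setT) y by rewrite sphi.
  by exists z, t.
have [x [_ Gx]] : [set: X] `&` cluster G !=set0.
  by apply: cptX; exact: filterT.
exists x; apply: hausdorff_entourage_eq => // A entA.
have [D symD DA] := sym_entourage_split3 entA.
have [delta symdelta dD] := eq D symD.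
have Gt : G [set z | exists2 t, D (p x, phi t x) & phi t z = y].
  by exists [set q : {ptws X -> X} | D (p x, q x)] => //;
    exact: near_eval symD.1.
have [z [[t pt tz] /xsectionP xz]] := Gx _ _ Gt (nbhs_entourage x symdelta.1).
apply: (DA _ _ _ _ pt (dD _ _ xz t)).
by rewrite tz; exact: entourage_refl symD.1.
Qed.

Lemma recurrent (f : X -> X) :
  (forall u : {ptws X -> X}, ellis phi u -> u \o u = u -> u = id) ->
  continuous f -> ellis phi f ->
  closure (range (fun n => iter n.+1 f : {ptws X -> X})) id.
Proof.
move=> uid fc Ef; have [u fu uu] := idempotent_power cptX hausX fc.
rewrite -(uid u _ uu) //; move: u fu {uu}.
(* The powers of [f] lie in the closed set [ellis phi], hence so do their limits. *)
apply: (@closure_image _ _ id) => [q|_ [n _ <-]]; first exact: cvg_id.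
exact: ellis_iter.
Qed.

(** Injectivity cancels [u] in [u (u x) = u x]. *)
Lemma distal_idempotent (u : {ptws X -> X}) :
  distal phi -> ellis phi u -> u \o u = u -> u = id.
Proof.
move=> dphi Eu uu; apply/funext => x; apply: (distal_ellis_inj dphi Eu).
by rewrite -[in RHS]uu.
Qed.

(** An idempotent fixes its image, which is everything. *)
Lemma equicontinuous_idempotent (u : {ptws X -> X}) :
  equicontinuous_semiflow phi -> surjective phi -> ellis phi u ->
  u \o u = u -> u = id.
Proof.
move=> eq sphi Eu uu; apply/funext => y.
have [x <-] := equicontinuous_ellis_surj y eq sphi Eu.
by rewrite -[in RHS]uu.
Qed.

Lemma equicontinuous_distal :
  equicontinuous_semiflow phi -> surjective phi -> distal phi.
Proof.
move=> eq sphi x y xy; apply: contrapT => prox; apply: xy.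
apply: hausdorff_entourage_eq => // A entA.
have [D symD DA] := sym_entourage_split3 entA.
have [delta symdelta dD] := ellis_equicontinuous eq symD.
have [t txy] : exists t, delta (phi t x, phi t y).
  by apply: contrapT => nt; apply: prox; exists delta => // t txy;
    apply: nt; exists t.
have rec := recurrent (fun u Eu => equicontinuous_idempotent eq sphi Eu)
  (@semiflow_continuous _ _ phi t) (@ellis_act t).
have [n [xn yn]] := closure_range_near2 x y rec symD.1.
apply: (DA _ _ _ _ xn _ (sym_entourageC symD yn)).
(* The exponent is positive, so one [phi t] acts first and brings the pair into [delta]; the
   remaining power lies in [ellis phi] and keeps it in [D]. *)
by rewrite !iterSr; apply: dD => //; exact/ellis_iter/ellis_act.
Qed.

Lemma distal_recurrent f : distal phi -> continuous f -> ellis phi f ->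
  closure (range (fun n => iter n.+1 f : {ptws X -> X})) id.
Proof. by move=> dphi; apply: recurrent => u; exact: distal_idempotent. Qed.

Lemma distal_invertible : distal phi -> invertible phi.
Proof.
move=> dphi t; have phitc := @semiflow_continuous _ _ phi t.
have rec := distal_recurrent dphi phitc (@ellis_act t).
have tcl : closed (range (phi t)).
  apply: compact_closed => //; apply: continuous_compact => //.
  exact: continuous_subspaceT.
have tsurj y : exists x, phi t x = y.
  suff [x _ <-] : range (phi t) y by exists x.
  (* By recurrence [y] is a limit of its images under positive powers, all in the range. *)
  apply: tcl; move: rec.
  apply: (@closure_image _ _ (fun q : {ptws X -> X} => q y)).
    exact: eval_continuous.
  by move=> _ [n _ <-]; apply: subset_closure; exists (iter n (phi t) y).
have tinj := distal_ellis_inj dphi (@ellis_act t).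
exists (fun y => sval (cid (tsurj y))) => x; last exact: svalP (cid (tsurj x)).
by apply: tinj; exact: svalP (cid (tsurj _)).
Qed.

(* As id lies in the closure of the positive powers of f, its inverse lies in
   the closure of the nonnegative ones. *)
Lemma distal_ellis_inv (f : homeo X) :
  distal phi -> ellis phi f -> ellis phi (homeo_inv f).
Proof.
move=> dphi Ef; have := distal_recurrent dphi (@homeo_continuous _ f) Ef.
apply: (@closure_image _ _
  (fun q : {ptws X -> X} => (homeo_inv f \o q : {ptws X -> X})) _ _ _ _ id).
  exact/postcomp_continuous/homeoV_continuous.
move=> _ [n _ <-]; have -> : homeo_inv f \o iter n.+1 f = iter n f.
  by apply/funext => x; rewrite /= homeoK.
exact: ellis_iter.
Qed.

(** The homeomorphisms in [ellis phi] form a subgroup containing those given by [T], hence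
    [gen_set phi]. *)
Lemma gen_act_ellis (g : gen_group phi) :
  distal phi -> ellis phi (gen_act g).
Proof.
move=> dphi; have /set_mem/(_ [set h : homeo X | ellis phi h]) := valP g.
apply; split; last first.
  by move=> h [t /funext ht]; rewrite /= ht; exact: ellis_act.
split; first exact: ellis_id.
- by move=> h k; exact: ellis_comp.
- by move=> h; exact: distal_ellis_inv.
Qed.

Lemma distal_gen_flow : distal phi -> distal (gen_flow phi).
Proof.
move=> dphi x y /(distal_ellis dphi)[beta symbeta xy].
by exists beta => // g; apply: xy; exact: gen_act_ellis.
Qed.

(** Invertibility gives surjectivity, hence distality, which is what places the generated group
    inside [ellis phi]. *)
Lemma equicontinuous_gen_flow : invertible phi ->
  equicontinuous_semiflow phi -> equicontinuous_semiflow (gen_flow phi).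
Proof.
move=> iphi eq eps symeps.
have sphi : surjective phi.
  move=> t; apply/seteqP; split=> // y _; have [g _ gK] := iphi t.
  by exists (g y).
have [delta symdelta dE] := ellis_equicontinuous eq symeps.
exists delta => // x y xy g; apply: (dE _ _ xy).
exact/gen_act_ellis/equicontinuous_distal.
Qed.

End ellis_semigroup.

Unset Implicit Arguments.
Set Strict Implicit.
Set Printing Implicit Defensive.

Theorem theorem1p13 (T : monoidType) (X : uniformType) (phi : semiflow T X)
    (infT : infinite_set [set: T]) (X0 : [set: X] !=set0)
    (cptX : compact [set: X]) (hausX : hausdorff_space X) :
  [/\ (equicontinuous_semiflow phi -> surjective phi -> distal phi),
      (distal phi -> invertible phi),
      (distal phi -> distal (gen_flow phi)) &
      (invertible phi -> equicontinuous_semiflow phi ->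
         equicontinuous_semiflow (gen_flow phi))].
Proof.
split.
- exact: equicontinuous_distal.
- exact: distal_invertible.
- exact: distal_gen_flow.
- exact: equicontinuous_gen_flow.
Qed.
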